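(* Let $R$ be a $\ast$-ring. The following two statements are equivalent: (1) $R$ is $\ast$-symmetric. (2) $r(a)=l(a^{\ast})$ for all $a\in R$.
   Context: All rings are associative with unity. A $\ast$-ring is a ring $R$ equipped with an involution $\ast$, i.e. a map $\ast:R\to R$ with $(x+y)^{\ast}=x^{\ast}+y^{\ast}$, $(xy)^{\ast}=y^{\ast}x^{\ast}$ and $(x^{\ast})^{\ast}=x$ for all $x,y\in R$. A $\ast$-ring $R$ is $\ast$-symmetric if for all $a,b,c\in R$, $abc=0$ implies $acb^{\ast}=0$. For $a\in R$, $l(a)=\{x\in R: xa=0\}$ and $r(a)=\{x\in R: ax=0\}$. *)

(* Defs.v *)
From mathcomp Require Import all_boot all_algebra.
From mathcomp Require Import classical_sets.

Set Implicit Arguments.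
Unset Strict Implicit.
Unset Printing Implicit Defensive.

Import GRing.Theory.
Local Open Scope classical_set_scope.
Local Open Scope ring_scope.

(* [pzRingType] is the structure of associative rings with unity, where the
   zero ring is allowed. A *-ring is such a ring together with a map satisfying
   [ring_involution]. *)
Definition ring_involution (R : pzRingType) (star : R -> R) : Prop :=
  [/\ {morph star : x y / x + y},
      {morph star : x y / x * y >-> y * x} &
      involutive star].

Definition star_symmetric (R : pzRingType) (star : R -> R) : Prop :=
  forall a b c : R, a * b * c = 0 -> a * c * star b = 0.

Definition left_annihilator (R : pzRingType) (a : R) : set R :=
  [set x : R | x * a = 0].

Definition right_annihilator (R : pzRingType) (a : R) : set R :=
  [set x : R | a * x = 0].

(* Main.v *)
Require Import Defs.
From mathcomp Require Import all_boot all_algebra.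
From mathcomp Require Import classical_sets.

(** The equality of annihilators says that [a x = 0] if and only if [x a* = 0]:
    the left factor of a vanishing product may be carried to the right end, at
    the price of a star, and back. Star-symmetry with [1] as leftmost factor
    gives the forward move. The involution turns that move into its own
    converse: [x a* = 0] is [a x* = 0] after starring, so the forward move gives
    [x* a* = 0], which is [a x = 0] starred. If both moves are available and
    [a b c = 0], carry [a b] across [c] to get [c b* a* = 0], since the
    involution reverses products; then carry only [a*] back, which leaves
    [a c b* = 0]. *)

Import GRing.Theory.
Local Open Scope ring_scope.

Lemma involution_eq0 (R : pzRingType) (star : R -> R) (x : R) :
  ring_involution star -> star x = 0 <-> x = 0.
Proof.
case=> starD _ starK.
have star0 : star 0 = 0 by apply: (addrI (star 0)); rewrite -starD !addr0.
by split=> [sx0|->//]; rewrite -(starK x) sx0.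
Qed.

Theorem theorem2p4 (R : pzRingType) (star : R -> R)
    (star_inv : ring_involution star) :
  star_symmetric star <->
  (forall a : R, right_annihilator a = left_annihilator (star a)).
Proof.
have star_eq0 x := involution_eq0 R star x star_inv.
have [_ starM starK] := star_inv.
split=> [sym a|annE a b c abc0].
  have flip u v : u * v = 0 -> v * star u = 0.
    by move=> uv0; rewrite -(mul1r v); apply: sym; rewrite mul1r.
  apply/seteqP; split=> x; first exact: flip.
  rewrite /left_annihilator /right_annihilator /= => xa0.
  apply/star_eq0; rewrite starM; apply: flip.
  by apply/star_eq0; rewrite starM starK.
have annP u v : u * v = 0 <-> v * star u = 0.
  have /seteqP[sub sup] := annE u.
  by split; [exact: sub | exact: sup].
by rewrite -mulrA; apply: (annP _ _).2; rewrite -mulrA -starM; apply: (annP _ _).1.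
Qed.
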